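(* Let $\mathbb V$ be a linear space, $f:\mathbb V\times\cdots\times\mathbb V\to\mathbb V$ an $n$-linear map and $\mathcal B=\{e_i\}_{i\in I}$ a fixed basis of $\mathbb V$. Then $\mathbb V$ decomposes as the $f$-orthogonal direct sum of linear subspaces $$\mathbb V=\bigoplus_{[e_i]\in\mathcal B/\sim}V_{[e_i]},$$ where $\sim$ is the connection relation on $\mathcal B$ and $V_{[e_i]}=\bigoplus_{e_j\in[e_i]}\mathbb Fe_j$.
   Context: Linear spaces are over an arbitrary field $\mathbb F$ and of arbitrary dimension; $n\ge 2$; $f:\mathbb V\times\cdots\times\mathbb V\to\mathbb V$ ($n$ factors) is $n$-linear. A superscript $(k)$ marks the $k$-th entry of $f$. Subspaces $V_1,V_2$ are $f$-orthogonal if $f(\mathbb V,\dots,V_1^{(i)},\dots,V_2^{(j)},\dots,\mathbb V)=0$ for all $i\ne j$ in $\{1,\dots,n\}$, i.e. $f$ vanishes whenever its $i$-th entry is in $V_1$ and its $j$-th entry is in $V_2$. A direct sum decomposition is $f$-orthogonal if its distinct summands are pairwise $f$-orthogonal. For each $e\in\mathcal B$ introduce a symbol $\overline e\notin\mathcal B$; $\overline{\mathcal B}=\{\overline e:e\in\mathcal B\}$, $\overline{(\overline e)}:=e$. Let $\mathbb V^*=\mathbb V\setminus\{0\}$ and $\mathcal P(\mathbb V^* )$ its power set. Define $F:\mathcal P(\mathbb V^* )\times(\mathcal B\dot\cup\overline{\mathcal B})^{n-1}\to\mathcal P(\mathbb V^* )$ as follows: $F(\emptyset,\dots)=\emptyset$;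 for $U\ne\emptyset$ and $\xi_1,\dots,\xi_{n-1}\in\mathcal B$, $$F(U,\xi_1,\dots,\xi_{n-1})=\Big(\bigcup_{1\le k\le n,\ \sigma\in\mathbb S_{n-1}}\{f(\xi_{\sigma(1)},\dots,u^{(k)},\dots,\xi_{\sigma(n-1)}):u\in U\}\Big)\setminus\{0\},$$ $$F(U,\overline\xi_1,\dots,\overline\xi_{n-1})=\Big(\bigcup_{1\le k\le n,\ \sigma\in\mathbb S_{n-1}}\{u\in\mathbb V:f(\xi_{\sigma(1)},\dots,u^{(k)},\dots,\xi_{\sigma(n-1)})\in U\}\Big)\setminus\{0\},$$ where $u$ is in the $k$-th entry and the remaining entries are filled in order by $\xi_{\sigma(1)},\dots,\xi_{\sigma(n-1)}$; and $F(U,\dots)=\emptyset$ if among the last $n-1$ arguments there is one in $\mathcal B$ and one in $\overline{\mathcal B}$. $e_i\in\mathcal B$ is connected to $e_j\in\mathcal B$ (written $e_i\sim e_j$) if $e_i=e_j$ or there is an ordered list $(X_1,\dots,X_m)$, $m\ge1$, of $(n-1)$-tuples $X_r\in(\mathcal B\dot\cup\overline{\mathcal B})^{n-1}$ such that $F(\{e_i\},X_1)\ne\emptyset$, $F(F(\{e_i\},X_1),X_2)\neq\emptyset$, ..., $F(\dots F(F(\{e_i\},X_1),X_2)\dots,X_{m-1})\ne\emptyset$ and $e_j\in F(F(\dots F(F(\{e_i\},X_1),X_2)\dots,X_{m-1}),X_m)$. This is an equivalence relation on $\mathcal B$; $[e_i]$ is the class of $e_i$. *)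

(* Defs.v *)
From HB Require Import structures.
From mathcomp Require Import all_boot all_order all_fingroup all_algebra.
From mathcomp Require Import boolp classical_sets cardinality fsbigop.

Set Implicit Arguments.
Unset Strict Implicit.
Unset Printing Implicit Defensive.

Import GRing.Theory.
Local Open Scope classical_set_scope.
Local Open Scope ring_scope.

Section LinearAlgebra.
Variables (K : fieldType) (V : lmodType K).
Implicit Types (J : choiceType).

(* [\sum_(j \in D) x j] is the library's sum over a possibly infinite set; it
   collapses to 0 when the support is infinite, hence the finiteness
   requirements below. *)

Definition is_basis (B : set V) : Prop :=
  (forall c : V -> K, finite_set [set e | B e /\ c e != 0] ->
     \sum_(e \in B) c e *: e = 0 -> forall e, B e -> c e = 0) /\
  (forall v : V, exists2 c : V -> K, finite_set [set e | B e /\ c e != 0] &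
     v = \sum_(e \in B) c e *: e).

Definition is_subspace (W : set V) : Prop :=
  W 0 /\ forall (a : K) (u v : V), W u -> W v -> W (a *: u + v).

Definition line (e : V) : set V := [set a *: e | a in [set: K]].

(* Choice of an element of [W j] for each [j] in [D], almost all of them 0. *)
Definition finite_selection J (D : set J) (W : J -> set V) (x : J -> V) : Prop :=
  (forall j, D j -> W j (x j)) /\ finite_set [set j | D j /\ x j != 0].

Definition sum_subspaces J (D : set J) (W : J -> set V) : set V :=
  [set v | exists2 x : J -> V, finite_selection D W x & v = \sum_(j \in D) x j].

(* [T] is the internal direct sum of the subspaces [W j], [j] in [D]. *)
Definition is_direct_sum J (D : set J) (W : J -> set V) (T : set V) : Prop :=
  [/\ forall j, D j -> is_subspace (W j),
      T = sum_subspaces D W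
    & forall x : J -> V, finite_selection D W x -> \sum_(j \in D) x j = 0 ->
        forall j, D j -> x j = 0].

End LinearAlgebra.

Section Multilinear.
Variables (K : fieldType) (V : lmodType K) (n : nat).
Implicit Types (f : {ffun 'I_n -> V} -> V).

(* The n-tuple with [u] in entry [k], the other entries being filled, in order,
   by the n - 1 vectors [x]. *)
Definition insert_at (k : 'I_n) (u : V) (x : 'I_n.-1 -> V) : {ffun 'I_n -> V} :=
  [ffun i => if unlift k i is Some j then x j else u].

Definition multilinear f : Prop :=
  forall (k : 'I_n) (x : 'I_n.-1 -> V), linear (fun u => f (insert_at k u x)).

Definition f_orthogonal f (V1 V2 : set V) : Prop :=
  forall (i j : 'I_n), i != j -> forall x : {ffun 'I_n -> V},
    V1 (x i) -> V2 (x j) -> f x = 0.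

Definition is_f_orthogonal_direct_sum f (J : choiceType) (D : set J)
    (W : J -> set V) (T : set V) : Prop :=
  is_direct_sum D W T /\
  forall j k, D j -> D k -> j <> k -> f_orthogonal f (W j) (W k).

End Multilinear.

Section Connection.
Variables (K : fieldType) (V : lmodType K) (n : nat).
Variables (f : {ffun 'I_n -> V} -> V) (B : set V).

(* Disjoint union of [B] and its barred copy: [inl e] stands for [e] and [inr e]
   for its barred symbol. *)
Definition symbol : Type := (B + B)%type.

Definition F_plain (U : set V) (xi : 'I_n.-1 -> B) : set V :=
  (\bigcup_(k in [set: 'I_n]) \bigcup_(s in [set: 'S_n.-1])
     [set f (insert_at k u (fun j => val (xi (s j)))) | u in U]) `\ 0.

Definition F_barred (U : set V) (xi : 'I_n.-1 -> B) : set V :=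
  (\bigcup_(k in [set: 'I_n]) \bigcup_(s in [set: 'S_n.-1])
     [set u | U (f (insert_at k u (fun j => val (xi (s j)))))]) `\ 0.

(* Only meant for [U] not containing 0 and [2 <= n]; it is empty if [U] is, or
   if [X] mixes plain and barred symbols. *)
Definition F (U : set V) (X : {ffun 'I_n.-1 -> symbol}) : set V :=
  [set v | exists2 xi : 'I_n.-1 -> B,
     X = [ffun j => inl (xi j)] & F_plain U xi v] `|`
  [set v | exists2 xi : 'I_n.-1 -> B,
     X = [ffun j => inr (xi j)] & F_barred U xi v].

(* [foldl F [set a] (take r Xs)] is F(..F(F({a}, X_1), X_2).., X_r). *)
Definition connected_to (a b : V) : Prop :=
  a = b \/
  exists Xs : seq {ffun 'I_n.-1 -> symbol},
    [/\ (1 <= size Xs)%N,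
        forall r : nat, (1 <= r < size Xs)%N ->
          foldl F [set a] (take r Xs) !=set0
      & foldl F [set a] Xs b].

Definition conn_class (a : V) : set V := [set b | B b /\ connected_to a b].

Definition conn_quotient : set (set V) := [set conn_class a | a in B].

Definition class_space (C : set V) : set V := sum_subspaces C (@line K V).

End Connection.

(* Main.v *)
Require Import Defs.
From mathcomp Require Import all_boot all_order all_fingroup all_algebra.
From mathcomp Require Import boolp classical_sets cardinality fsbigop.
From Stdlib Require Import Relation_Operators Operators_Properties.

Set Implicit Arguments.
Unset Strict Implicit.
Unset Printing Implicit Defensive.

Import GRing.Theory.
Local Open Scope classical_set_scope.
Local Open Scope ring_scope.

(** Two independent facts carry the proof.

    Linear algebra: any partition of a basis into classes splits the space into
    the direct sum of the spans of the classes. Coordinates make this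
    immediate, because the span of a class is the set of vectors whose
    coordinates off the class vanish ([class_spaceP]): the summand in the class
    of [e] is the only one that contributes to the coordinate of a sum at [e],
    so a sum and its summands determine each other coordinate by coordinate
    ([is_direct_sum_partition]).

    Connection: a single application of the operator with plain symbols sends
    [u] to a nonzero value of [f] having [u] among its entries, the others
    being basis vectors; with barred symbols it goes the other way. Hence one
    step from a nonzero vector can always be undone ([linked_sym]), and
    connection, which is the reflexive transitive closure of such steps
    ([connected_toP]), is an equivalence relation on the basis.

    The two meet in the orthogonality. If all entries of [f] are basis vectors
    and the value [v] is nonzero, any two entries [a] and [b] are connected
    through [v]: go up from [a] to [v], then down from [v] to [b]
    ([connected_to_entries]). So [f] vanishes on basis vectors as soon as two
    entries are in different classes, and by multilinearity it vanishes on the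
    corresponding spans ([multilinear_eq0_span]). *)

(** * Sums with finite support *)

(** Sums with different supports can be combined only over a common finite
    index set; this brings any of them to such a set. *)
Lemma fsum_support (U : nmodType) (J : choiceType) (D S : set J) (x : J -> U) :
  [set j | D j /\ x j != 0] `<=` S ->
  \sum_(j \in D) x j = \sum_(j \in D `&` S) x j.
Proof.
move=> DS; symmetry; apply: fsbig_widen => [j []//|j [Dj nDSj] /=].
by apply: contra_notP nDSj => /eqP xj; split=> //; apply: DS.
Qed.

Lemma fsum_morph (U U' : nmodType) (g : U -> U') (J : choiceType) (D : set J)
    (x : J -> U) :
  g 0 = 0 -> {morph g : u v / u + v} -> finite_set [set j | D j /\ x j != 0] ->
  g (\sum_(j \in D) x j) = \sum_(j \in D) g (x j).
Proof.
move=> g0 gD fin; have finI := finite_setIr D fin.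
rewrite (fsum_support (x := x) (fun j => id)).
rewrite (@fsum_support _ _ D [set j | D j /\ x j != 0] (g \o x)) => [|j] /=.
  by rewrite !fsbig_finite // (big_morph g gD g0).
by move=> [Dj gx]; split=> //; apply: contraNneq gx => ->; rewrite g0.
Qed.

Lemma fsumD (U : nmodType) (J : choiceType) (D : set J) (x y : J -> U) :
  finite_set [set j | D j /\ x j != 0] -> finite_set [set j | D j /\ y j != 0] ->
  \sum_(j \in D) (x j + y j) = \sum_(j \in D) x j + \sum_(j \in D) y j.
Proof.
move=> finx finy.
pose S := [set j | D j /\ x j != 0] `|` [set j | D j /\ y j != 0].
have fin : finite_set S by rewrite finite_setU.
rewrite (fsum_support (S := S) (x := x)) => [|j]; last by left.
rewrite (fsum_support (S := S) (x := y)) => [|j]; last by right.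
rewrite (fsum_support (S := S) (x := fun j => x j + y j)) => [|j [Dj xyj]].
  by rewrite fsbig_split //; apply: finite_setIr.
have [xj|xj] := eqVneq (x j) 0; last by left.
by right; split=> //; rewrite xj add0r in xyj.
Qed.

Lemma fsum_one (U : nmodType) (J : choiceType) (D : set J) (x : J -> U) j :
  D j -> (forall k, D k -> k <> j -> x k = 0) -> \sum_(k \in D) x k = x j.
Proof.
move=> Dj x0; rewrite -(@fsbig_widen _ _ _ _ [set j]) ?fsbig_set1 // => [k ->//|].
by move=> k [Dk kj]; apply: x0.
Qed.

(** * Coordinates in a basis *)

Section Coordinates.
Variables (K : fieldType) (V : lmodType K) (B : set V).

(** The family of linear functionals dual to the basis [B]. *)
Definition coordinate_system (phi : V -> V -> K) : Prop :=
  [/\ forall e a u v, B e -> phi e (a *: u + v) = a * phi e u + phi e v,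
      forall v, finite_set [set e | B e /\ phi e v != 0],
      forall v, v = \sum_(e \in B) phi e v *: e
    & forall e b, B e -> B b -> phi e b = (e == b)%:R].

Lemma scale_support (c : V -> K) :
  finite_set [set e | B e /\ c e != 0] ->
  finite_set [set e | B e /\ c e *: e != 0].
Proof.
apply: sub_finite_set => e [Be ce]; split=> //.
by apply: contraNneq ce => ->; rewrite scale0r.
Qed.

Lemma basis_expansion_uniq (c c' : V -> K) :
  is_basis B ->
  finite_set [set e | B e /\ c e != 0] -> finite_set [set e | B e /\ c' e != 0] ->
  \sum_(e \in B) c e *: e = \sum_(e \in B) c' e *: e ->
  forall e, B e -> c e = c' e.
Proof.
move=> [free _] fc fc' eqc e Be.
apply/eqP; rewrite -subr_eq0; apply/eqP.
apply: (free (fun e => c e - c' e)) Be.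
  have : finite_set ([set e | B e /\ c e != 0] `|` [set e | B e /\ c' e != 0]).
    by rewrite finite_setU.
  apply: sub_finite_set => b [Bb /= cb].
  have [c0|?] := eqVneq (c b) 0; last by left.
  by right; split=> //; move: cb; rewrite c0 sub0r oppr_eq0.
have -> : \sum_(b \in B) (c b - c' b) *: b =
          \sum_(b \in B) (c b *: b + - (c' b *: b)).
  by apply: eq_fsbigr => b _; rewrite scalerBl.
rewrite fsumD; first 1 last.
- exact: scale_support.
- apply: sub_finite_set (scale_support fc') => b [Bb].
  by rewrite oppr_eq0.
rewrite -(@fsum_morph _ _ (@GRing.opp V)) ?oppr0 ?eqc ?subrr //.
- exact: opprD.
- exact: scale_support.
Qed.

(** The expansion of each vector is only given to exist; uniqueness is what
    makes the chosen coefficients linear in the vector. *)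
Lemma basis_coordinates : is_basis B -> exists phi, coordinate_system phi.
Proof.
move=> hB; have [_ span] := hB.
have /choice [c hc] : forall v, exists c : V -> K,
    finite_set [set e | B e /\ c e != 0] /\ v = \sum_(e \in B) c e *: e.
  by move=> v; have [c fc vc] := span v; exists c.
have fc v := (hc v).1; have sc v := (hc v).2.
exists (fun e v => c v e); split=> //.
- move=> e a u v Be.
  have fau : finite_set [set e | B e /\ a * c u e != 0].
    apply: sub_finite_set (fc u) => b [Bb au]; split=> //.
    by apply: contraNneq au => ->; rewrite mulr0.
  apply: (@basis_expansion_uniq _ (fun e => a * c u e + c v e)) Be => //.
    have : finite_set ([set e | B e /\ c u e != 0] `|` [set e | B e /\ c v e != 0]).
      by rewrite finite_setU.
    apply: sub_finite_set => b [Bb /= cb].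
    have [c0|?] := eqVneq (c u b) 0; last by left.
    by right; split=> //; move: cb; rewrite c0 mulr0 add0r.
  rewrite -sc.
  have -> : \sum_(b \in B) (a * c u b + c v b) *: b =
            \sum_(b \in B) (a *: (c u b *: b) + c v b *: b).
    by apply: eq_fsbigr => b _; rewrite scalerDl scalerA.
  rewrite fsumD; first 1 last.
  + apply: sub_finite_set (scale_support fau) => b [Bb].
    by rewrite scalerA.
  + exact: scale_support.
  rewrite -(@fsum_morph _ _ (fun w => a *: w)) ?scaler0 -?sc //.
  + exact: scalerDr.
  + exact: scale_support.
- move=> e b Be Bb.
  apply: (@basis_expansion_uniq _ (fun e => (e == b)%:R)) Be => //.
    apply: sub_finite_set (finite_set1 b) => d [_] /=.
    by have [->|] := eqVneq d b; rewrite ?eqxx.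
  rewrite -sc (@fsum_one _ _ _ _ b) ?eqxx ?scale1r // => d _ /eqP/negPf ->.
  by rewrite scale0r.
Qed.

Variable phi : V -> V -> K.
Hypothesis phiP : coordinate_system phi.

Lemma coord0 e : B e -> phi e 0 = 0.
Proof.
by have [lin _ _ _] := phiP => /(lin e (-1) 0 0); rewrite scaler0 addr0 mulN1r addNr.
Qed.

Lemma coordD e : B e -> {morph phi e : u v / u + v}.
Proof.
by have [lin _ _ _] := phiP => Be u v; have := lin e 1 u v Be; rewrite scale1r mul1r.
Qed.

Lemma coordZ e a u : B e -> phi e (a *: u) = a * phi e u.
Proof.
have [lin _ _ _] := phiP => Be.
by have := lin e a u 0 Be; rewrite !addr0 coord0 // addr0.
Qed.

Lemma coord_inj u v : (forall e, B e -> phi e u = phi e v) -> u = v.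
Proof.
have [_ _ expand _] := phiP => uv.
by rewrite (expand u) (expand v); apply: eq_fsbigr => e /set_mem /uv ->.
Qed.

Lemma coord_fsum (J : choiceType) (D : set J) (x : J -> V) e :
  B e -> finite_set [set j | D j /\ x j != 0] ->
  phi e (\sum_(j \in D) x j) = \sum_(j \in D) phi e (x j).
Proof. by move=> Be; apply: fsum_morph; [apply: coord0|apply: coordD]. Qed.

(** Membership in a span becomes a condition on each coordinate separately;
    closure properties and independence then reduce to identities in [K]. *)
Lemma class_spaceP (C : set V) (v : V) : C `<=` B ->
  class_space C v <-> forall e, B e -> ~ C e -> phi e v = 0.
Proof.
have [_ fin expand delta] := phiP => CB; split.
  move=> [x [xline finx] ->] e Be Ce; rewrite coord_fsum //.
  apply: fsbig1 => b Cb; have [a _ <-] := xline b Cb.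
  rewrite coordZ // delta //; last exact: CB.
  have [eb|_] := eqVneq e b; last by rewrite mulr0.
  by rewrite eb in Ce.
move=> v0; exists (fun e => phi e v *: e).
  split=> [e _|]; first by exists (phi e v).
  apply: sub_finite_set (scale_support (fin v)) => e [Ce pe].
  by split=> //; apply: CB.
rewrite [LHS]expand; symmetry; apply: fsbig_widen => // e [Be Ce] /=.
by rewrite v0 ?scale0r.
Qed.

Lemma is_direct_sum_lines (C : set V) :
  C `<=` B -> is_direct_sum C (@line K V) (class_space C).
Proof.
have [_ _ _ delta] := phiP => CB; split=> // [e _|x [xline finx] sum0 e Ce].
  split=> [|a _ _ [b _ <-] [c _ <-]]; first by exists 0; rewrite ?scale0r.
  by exists (a * b + c) => //; rewrite scalerDl scalerA.
have [a _ xe] := xline e Ce; rewrite -xe.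
suff -> : a = 0 by rewrite scale0r.
have := coord_fsum (CB _ Ce) finx; rewrite sum0 coord0; last exact: CB.
rewrite (@fsum_one _ _ _ _ e) // => [|b Cb be].
  by rewrite -xe coordZ ?delta ?eqxx ?mulr1 => [->|||]; try exact: CB.
have [a' _ <-] := xline b Cb; rewrite coordZ; last exact: CB.
rewrite delta; try exact: CB.
by rewrite eq_sym (introF eqP be) mulr0.
Qed.

(** The partition is given by the map [cl] sending a basis vector to its
    class. Both existence and uniqueness of the decomposition come from [pick]:
    the coordinate at [e] of a sum over the classes is that of its summand at
    [cl e], so the summand at [C] must be the part of the expansion supported
    on [C]. *)
Lemma is_direct_sum_partition (cl : V -> set V) :
  (forall e, B e -> cl e e) -> (forall e, B e -> cl e `<=` B) ->
  (forall e b, B e -> cl e b -> cl b = cl e) ->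
  is_direct_sum [set cl e | e in B] (@class_space K V) [set: V].
Proof.
have [_ fin expand delta] := phiP => cl_refl clB cl_eq.
have clsub C : [set cl e | e in B] C -> C `<=` B by move=> [e Be <-]; apply: clB.
have pick (x : set V -> V) : (forall C, [set cl e | e in B] C -> class_space C (x C)) ->
    forall e, B e -> \sum_(C \in [set cl e | e in B]) phi e (x C) = phi e (x (cl e)).
  move=> xP e Be; apply: fsum_one => [|C QC Ce]; first by exists e.
  have [b Bb bC] := QC.
  apply: (class_spaceP _ (clsub _ QC)).1 => //; first exact: xP.
  by rewrite -bC => be; apply: Ce; rewrite -bC (cl_eq b e).
split.
- move=> C QC; split=> [|a u v].
    by apply/class_spaceP => [|e Be _]; [apply: clsub|rewrite coord0].
  have CB := clsub _ QC.
  move=> /(class_spaceP _ CB) u0 /(class_spaceP _ CB) v0; apply/(class_spaceP _ CB).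
  by move=> e Be Ce; rewrite coordD // coordZ // u0 // v0 // mulr0 addr0.
- symmetry; apply/seteqP; split=> // v _.
  pose x (C : set V) := \sum_(e \in C) phi e v *: e.
  have xsel C : [set cl e | e in B] C ->
      finite_selection C (@line K V) (fun e => phi e v *: e).
    move=> QC; split=> [e _|]; first by exists (phi e v).
    apply: sub_finite_set (scale_support (fin v)) => e [Ce pe].
    by split=> //; apply: (clsub _ QC _ Ce).
  have xP C : [set cl e | e in B] C -> class_space C (x C).
    by move=> QC; exists (fun e => phi e v *: e) => //; apply: xsel.
  have finx : finite_set [set C | [set cl e | e in B] C /\ x C != 0].
    apply: sub_finite_set (finite_image cl (fin v)) => C [QC].
    move=> /(@fsbigN1 _ _ _ _ _ C (fun _ e => phi e v *: e) tt) [e Ce pe].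
    have [b Bb bC] := QC; exists e.
      split; first exact: (clsub _ QC _ Ce).
      by apply: contraNneq pe => ->; rewrite scale0r.
    by rewrite -bC; apply: cl_eq => //; rewrite bC.
  exists x; first by split.
  apply: coord_inj => e Be; rewrite coord_fsum // pick //.
  have Qe : [set cl e | e in B] (cl e) by exists e.
  rewrite coord_fsum //; last exact: (xsel _ Qe).2.
  rewrite (@fsum_one _ _ _ _ e) ?coordZ ?(delta e e) ?eqxx ?mulr1 //; first exact: cl_refl.
  move=> b Cb be; rewrite coordZ // (delta e b) //; last exact: (clsub _ Qe _ Cb).
  by rewrite eq_sym (introF eqP be) mulr0.
- move=> x [xP finx] sum0 C QC; apply: coord_inj => e Be; rewrite coord0 //.
  have [Ce|Ce] := pselect (C e); last first.
    exact: (class_spaceP _ (clsub _ QC)).1 (xP _ QC) e Be Ce.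
  have [b Bb bC] := QC.
  have <- : cl e = C by rewrite -bC; apply: cl_eq => //; rewrite bC.
  by rewrite -pick // -coord_fsum // sum0 coord0.
Qed.

End Coordinates.

(** * Multilinear maps *)

Section Multilinear.
Variables (K : fieldType) (V : lmodType K) (n : nat).
Implicit Types (f : {ffun 'I_n -> V} -> V) (x : {ffun 'I_n -> V}).

Lemma insert_at_lift (k : 'I_n) x : insert_at k (x k) (fun j => x (lift k j)) = x.
Proof.
by apply/ffunP => i; rewrite ffunE; case: unliftP => [j ->|->].
Qed.

Lemma insert_at_self (k : 'I_n) (u : V) y : insert_at k u y k = u.
Proof. by rewrite ffunE unlift_none. Qed.

Lemma insert_at_other (k i : 'I_n) (u : V) x :
  i != k -> insert_at k u (fun j => x (lift k j)) i = x i.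
Proof. by rewrite ffunE; case: unliftP => [j ->|->]; rewrite ?eqxx. Qed.

Lemma multilinear_fsum f (J : choiceType) (D : set J) (y : J -> V) k z :
  multilinear f -> finite_set [set j | D j /\ y j != 0] ->
  f (insert_at k (\sum_(j \in D) y j) z) = \sum_(j \in D) f (insert_at k (y j) z).
Proof.
move=> hf; apply: (fsum_morph (g := fun u => f (insert_at k u z))) => [|u v].
  by have := hf k z (-1) 0 0; rewrite scaler0 addr0 scaleN1r addNr.
by have := hf k z 1 u v; rewrite !scale1r.
Qed.

Lemma multilinearZ f k z (a : K) (u : V) : multilinear f ->
  f (insert_at k (a *: u) z) = a *: f (insert_at k u z).
Proof.
move=> hf; have := hf k z (-1) 0 0; rewrite scaler0 addr0 scaleN1r addNr => f0.
by have := hf k z a u 0; rewrite f0 !addr0.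
Qed.

(** The entries are expanded one at a time: [m] bounds the positions that
    still hold an arbitrary vector of the span, the later ones already holding
    a generator. *)
Lemma multilinear_eq0_span f (D : 'I_n -> set V) : multilinear f ->
  (forall x, (forall k, D k (x k)) -> f x = 0) ->
  forall x, (forall k, class_space (D k) (x k)) -> f x = 0.
Proof.
move=> hf f0.
suff H m x : (forall k : 'I_n, (k < m)%N -> class_space (D k) (x k)) ->
    (forall k : 'I_n, (m <= k)%N -> D k (x k)) -> f x = 0.
  move=> x hx; apply: (H n) => [k _|k]; first exact: hx.
  by rewrite leqNgt ltn_ord.
elim: m x => [|m IH] x hlo hhi; first by apply: f0 => k; apply: hhi.
have [mn|nm] := ltnP m n; last first.
  apply: IH => k km; first by apply: hlo; apply: ltnW.
  by have := leq_trans (leq_trans (ltn_ord k) nm) km; rewrite ltnn.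
pose k := Ordinal mn; have [y [yline finy] xk] := hlo k (ltnSn m).
rewrite -(insert_at_lift k x) xk multilinear_fsum //.
apply: fsbig1 => e De; have [a _ <-] := yline e De.
rewrite multilinearZ // IH ?scaler0 // => i im.
  rewrite insert_at_other; first by apply: hlo; apply: ltnW.
  by apply: contraTneq im => ->; rewrite ltnn.
have [->|ik] := eqVneq i k; first by rewrite insert_at_self.
by rewrite insert_at_other //; apply: hhi; rewrite ltn_neqAle eq_sym ik.
Qed.

End Multilinear.

(** * Connection as the closure of a symmetric relation *)

Section Connection.
Variables (K : fieldType) (V : lmodType K) (n : nat).
Variables (f : {ffun 'I_n -> V} -> V) (B : set V).

(** One application of the operator [F] to a singleton, with plain symbols in
    the first alternative and barred ones in the second. The permutation of the
    symbols is absorbed in the quantification over [y]. *)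
Definition linked (u v : V) : Prop :=
  v != 0 /\ exists k (y : 'I_n.-1 -> V), (forall j, B (y j)) /\
    (v = f (insert_at k u y) \/ u = f (insert_at k v y)).

(** The two alternatives are exchanged by swapping the vectors; only the
    condition that the end point is nonzero is not symmetric. *)
Lemma linked_sym u v : u != 0 -> linked u v -> linked v u.
Proof.
move=> u0 [v0 [k [y [yB uv]]]]; split=> //; exists k, y; split=> //.
by case: uv; [right|left].
Qed.

Lemma F_linked U (X : {ffun 'I_n.-1 -> symbol B}) v :
  F f U X v -> exists2 u, U u & linked u v.
Proof.
have yB (y : 'I_n.-1 -> B) (s : 'S_n.-1) j : B (val (y (s j))).
  exact: set_valP.
case=> [[y _ [[k _ [s _ [u Uu uv]]] /eqP v0]]|[y _ [[k _ [s _ Uv]] /eqP v0]]].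
  exists u => //; split=> //; exists k, (fun j => val (y (s j))).
  by split=> //; left.
exists (f (insert_at k v (fun j => val (y (s j))))) => //.
by split=> //; exists k, (fun j => val (y (s j))); split=> //; right.
Qed.

Lemma linked_F (U : set V) u v : U u -> linked u v ->
  exists X : {ffun 'I_n.-1 -> symbol B}, F f U X v.
Proof.
move=> Uu [v0 [k [y [yB uv]]]].
pose xi j : B := SigSub (mem_set (yB j)).
have xiE : (fun j => val (xi ((1%g : 'S_n.-1) j))) = y.
  by apply/funext => j; rewrite perm1.
case: uv => uv; [exists [ffun j => inl (xi j)]; left|exists [ffun j => inr (xi j)]; right].
  exists xi => //; split; last exact/eqP.
  by exists k => //; exists 1%g => //; exists u => //; rewrite xiE.
exists xi => //; split; last exact/eqP.
by exists k => //; exists 1%g => //=; rewrite xiE -uv.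
Qed.

(** [F] acts elementwise, so the elements of an iterated image are the end
    points of chains of links. *)
Lemma foldl_F_linked Xs (U : set V) b : foldl (F f (B := B)) U Xs b ->
  exists2 a, U a & clos_refl_trans V linked a b.
Proof.
elim: Xs U => [|X Xs IH] U /=; first by exists b => //; apply: rt_refl.
move=> /IH [a /F_linked [u Uu ua] ab]; exists u => //.
by apply: rt_trans ab; apply: rt_step.
Qed.

Lemma linked_foldl_F a b : clos_refl_trans V linked a b ->
  forall U : set V, U a -> exists Xs, foldl (F f (B := B)) U Xs b.
Proof.
move=> ab; elim: (clos_rt_rt1n _ _ _ _ ab) => {a b ab} [a|a c b ac _ IH] U Ua.
  by exists [::].
have [X Xc] := linked_F Ua ac; have [Xs XsP] := IH _ Xc.
by exists (X :: Xs).
Qed.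

(** The nonemptiness of the intermediate images is automatic: each contains a
    vector of the chain leading to [b]. *)
Lemma connected_toP a b : connected_to f B a b <-> clos_refl_trans V linked a b.
Proof.
split=> [[->|[Xs [_ _ /foldl_F_linked [_ -> //]]]]|ab]; first exact: rt_refl.
have [[|X Xs]] := linked_foldl_F ab (erefl : [set a] a); first by move=> ->; left.
(* The chain without links is the case [a = b]; the list is now nonempty. *)
set Ys := X :: Xs => YsP; right; exists Ys; split=> // r _.
move: YsP; rewrite -{1}(cat_take_drop r Ys) foldl_cat.
by move=> /foldl_F_linked [c rc _]; exists c.
Qed.

Lemma connected_to_trans a b c :
  connected_to f B a b -> connected_to f B b c -> connected_to f B a c.
Proof.
move=> /connected_toP ab /connected_toP bc; apply/connected_toP.
exact: rt_trans ab bc.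
Qed.

(** Every vector reached along a chain is nonzero, so the chain can be reversed
    link by link once its starting point is nonzero. *)
Lemma connected_to_sym a b :
  a != 0 -> connected_to f B a b -> connected_to f B b a.
Proof.
move=> a0 /connected_toP ab; apply/connected_toP.
elim: (clos_rt_rt1n _ _ _ _ ab) a0 => {a b ab} [a|a c b ac _ IH] a0; first exact: rt_refl.
by apply: rt_trans (IH ac.1) _; apply: rt_step; apply: linked_sym.
Qed.

(** The path goes through [f x], in one plain and one barred step. *)
Lemma connected_to_entries (x : {ffun 'I_n -> V}) i j :
  (forall k, B (x k)) -> x j != 0 -> f x != 0 -> connected_to f B (x i) (x j).
Proof.
move=> xB xj0 fx0; apply/connected_toP; apply: (@rt_trans _ _ _ (f x)).
  apply: rt_step; split=> //; exists i, (fun m => x (lift i m)); split=> //.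
  by left; rewrite insert_at_lift.
apply: rt_step; split=> //; exists j, (fun m => x (lift j m)); split=> //.
by right; rewrite insert_at_lift.
Qed.

End Connection.

Theorem proposition2p10 (K : fieldType) (V : lmodType K) (n : nat)
    (hn : (2 <= n)%N) (f : {ffun 'I_n -> V} -> V) (hf : multilinear f)
    (B : set V) (hB : is_basis B) :
  (forall C : set V, conn_quotient f B C ->
     is_direct_sum C (@line K V) (class_space C)) /\
  is_f_orthogonal_direct_sum f (conn_quotient f B) (@class_space K V) [set: V].
Proof.
have [phi phiP] := basis_coordinates hB; have [_ _ _ delta] := phiP.
have B0 e : B e -> e != 0.
  move=> Be; apply/eqP => e0; have := delta e e Be Be.
  by rewrite eqxx {2}e0 (coord0 phiP) // => /esym/eqP; rewrite oner_eq0.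
have cl_refl e : B e -> conn_class f B e e by move=> Be; split=> //; left.
have clB e : conn_class f B e `<=` B by move=> b [].
have cl_eq e b : B e -> conn_class f B e b -> conn_class f B b = conn_class f B e.
  move=> Be [Bb eb]; apply/seteqP; split=> d [Bd cd]; split=> //.
    exact: connected_to_trans eb cd.
  exact: connected_to_trans (connected_to_sym (B0 _ Be) eb) cd.
split=> [C [e Be <-]|]; first exact: (is_direct_sum_lines phiP).
split; first exact: (is_direct_sum_partition phiP).
move=> C C' [a Ba aC] [a' Ba' aC'] CC' i j ij x xi xj.
(* All entries but the [i]-th and [j]-th are only known to lie in the span of
   the whole basis. *)
pose D k := if k == i then C else if k == j then C' else B.
apply: (multilinear_eq0_span (D := D)) => // [y yD|k]; last first.
  rewrite /D; case: eqVneq => [->//|_]; case: eqVneq => [->//|_].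
  by apply/(class_spaceP phiP).
have yB k : B (y k).
  have := yD k; rewrite /D; case: eqVneq => _; first by rewrite -aC => -[].
  by case: eqVneq => _ //; rewrite -aC' => -[].
apply: contra_notP CC' => /eqP fy0.
have yiC : conn_class f B a (y i) by have := yD i; rewrite /D eqxx aC.
have yjC : conn_class f B a' (y j).
  by have := yD j; rewrite /D eqxx eq_sym (negPf ij) aC'.
rewrite -aC -aC' -(cl_eq _ _ Ba yiC) -(cl_eq _ _ Ba' yjC).
by symmetry; apply: cl_eq => //; split=> //; apply: connected_to_entries => //; apply: B0.
Qed.
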